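(* Let $\Gamma,p\colon\mathbb{R}\to\mathbb{R}$ be BPUC functions and define $\hat\lambda\colon\mathbb{R}\to\mathbb{R}$ by $\hat\lambda(c):=\lambda^*(2c\,\Gamma,\,p-c^2\Gamma^2)$. Then: (i) for every $\kappa>0$ there exists $m_\kappa>0$ such that, if $c_1,c_2\in[-\kappa,\kappa]$, then $|\hat\lambda(c_1)-\hat\lambda(c_2)|\le m_\kappa|c_1-c_2|$. In particular, $\hat\lambda$ is continuous and locally Lipschitz on $\mathbb{R}$. (ii) If, in addition, $\Gamma$ is $C^1$ and $\|\Gamma'\|:=\sup_{t\in\mathbb{R}}|\Gamma'(t)|<\infty$, then $|\hat\lambda(c_1)-\hat\lambda(c_2)|\le\|\Gamma'\|\,|c_1-c_2|$ for all $c_1,c_2\in\mathbb{R}$. That is, under these conditions, $\hat\lambda$ is Lipschitz on $\mathbb{R}$.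
   Context: BPUC functions: a set $\Delta=\{a_j\mid j\in\mathbb{Z}\}\subset\mathbb{R}$ is disperse if $\inf_{j\in\mathbb{Z}}(a_{j+1}-a_j)>0$. $BPUC_\Delta(\mathbb{R},\mathbb{R})$ is the set of bounded right-continuous functions $q\colon\mathbb{R}\to\mathbb{R}$ such that for all $\varepsilon>0$ there is $\delta>0$ such that, if $t_1,t_2\in(a_j,a_{j+1})$ for some $j\in\mathbb{Z}$ and $|t_2-t_1|<\delta$, then $|q(t_2)-q(t_1)|<\varepsilon$. A function $q$ is BPUC if $q=q_1+\cdots+q_n$ with $q_i\in BPUC_{\Delta_i}(\mathbb{R},\mathbb{R})$ for finitely many disperse sets $\Delta_1,\dots,\Delta_n$. Bifurcation value: for BPUC functions $q,p$, $\lambda^*(q,p)$ is the unique real number such that $x'=-x^2+q(t)x+p(t)+\lambda$ has a solution defined and bounded on $\mathbb{R}$ if and only if $\lambda\ge\lambda^*(q,p)$ (such a number exists). Thus $\hat\lambda(c)$ is the corresponding value for $x'=-(x-c\,\Gamma(t))^2+p(t)+\lambda$. Solutions are in the Carathéodory sense (absolutely continuous on compact intervals, satisfying the equation a.e.). *)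

(* Defs.v *)
From HB Require Import structures.
From mathcomp Require Import all_boot all_order all_algebra.
From mathcomp Require Import all_classical all_reals all_analysis.
Import Order.TTheory GRing.Theory Num.Theory.
Import numFieldNormedType.Exports.

Set Implicit Arguments.
Unset Strict Implicit.
Unset Printing Implicit Defensive.

Local Open Scope classical_set_scope.
Local Open Scope ring_scope.

(** A disperse set {a_j | j in Z} is given by its enumeration [a].  The real
    [inf] is 0 on sets that are not bounded below, so the strict inequality
    also says that the gaps are bounded below. *)
Definition disperse (R : realType) (a : int -> R) : Prop :=
  0 < inf (range (fun j : int => a (j + 1) - a j)).

Definition BPUC_on (R : realType) (a : int -> R) (q : R -> R) : Prop :=
  [/\ [bounded q t | t in [set: R]],
      (forall t : R, q s @[s --> t^'+] --> q t) &
      (forall eps : R, 0 < eps -> exists2 delta : R, 0 < delta &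
         forall (j : int) (t1 t2 : R),
           t1 \in `]a j, a (j + 1)[ -> t2 \in `]a j, a (j + 1)[ ->
           `|t2 - t1| < delta -> `|q t2 - q t1| < eps)].

Definition BPUC (R : realType) (q : R -> R) : Prop :=
  exists (n : nat) (a : 'I_n.+1 -> int -> R) (q_ : 'I_n.+1 -> R -> R),
    (forall i, disperse (a i) /\ BPUC_on (a i) (q_ i)) /\
    (forall t, q t = \sum_(i < n.+1) q_ i t).

Definition abs_continuous_on (R : realType) (a b : R) (x : R -> R) : Prop :=
  forall eps : R, 0 < eps -> exists2 delta : R, 0 < delta &
    forall (n : nat) (u v : 'I_n -> R),
      (forall i, a <= u i /\ u i <= v i /\ v i <= b) ->
      trivIset [set: 'I_n] (fun i => `]u i, v i[%classic) ->
      \sum_(i < n) (v i - u i) < delta ->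
      \sum_(i < n) `|x (v i) - x (u i)| < eps.

(** Solutions, on the whole line, of x' = f(t, x). *)
Definition caratheodory_solution (R : realType) (f : R -> R -> R)
    (x : R -> R) : Prop :=
  (forall a b : R, a <= b -> abs_continuous_on a b x) /\
  {ae @lebesgue_measure R, forall t : R, is_derive t 1 x (f t (x t))}.

Definition has_bounded_solution (R : realType) (q p : R -> R) (l : R) : Prop :=
  exists x : R -> R,
    caratheodory_solution (fun t y => - y ^+ 2 + q t * y + p t + l) x /\
    [bounded x t | t in [set: R]].

Definition is_bifurcation_value (R : realType) (q p : R -> R) (l0 : R) : Prop :=
  forall l : R, has_bounded_solution q p l <-> l0 <= l.

(** The bifurcation value, as a definite description: [is_bifurcation_value q p]
    holds of at most one real, and of exactly one when [q] and [p] are BPUC.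
    The default 0 only matters when there is none. *)
Definition lambda_star (R : realType) (q p : R -> R) : R :=
  xget 0 [set l0 | is_bifurcation_value q p l0].

Definition lambda_hat (R : realType) (Gamma p : R -> R) (c : R) : R :=
  lambda_star (fun t => 2 * c * Gamma t)
              (fun t => p t - c ^+ 2 * Gamma t ^+ 2).

(** Finite only if [f] is bounded; [sup] is 0 otherwise. *)
Definition sup_norm (R : realType) (f : R -> R) : R :=
  sup (range (fun t => `|f t|)).

(* Main.v *)
Require Import Defs.
From mathcomp Require Import all_boot all_order all_algebra.
From mathcomp Require Import all_classical all_reals all_analysis.
From mathcomp Require Import lra.
Import Order.TTheory GRing.Theory Num.Theory.
Import numFieldNormedType.Exports.

Local Open Scope classical_set_scope.
Local Open Scope ring_scope.

(** Write the equation as x' = F(t, x) with F(t, y) = - y^2 + q(t) y + p(t) + l.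
    The argument rests on one fact: if some bounded Lipschitz function w is a
    subsolution, w' <= F(t, w), then the equation has a bounded solution.  Given
    this, both estimates are comparisons between the equations for two values
    of c.  Let x be a bounded solution for c1 at its bifurcation value l.
    - x is a subsolution for c2 at the level l + m |c1 - c2|, because replacing
      c1 by c2 changes - (x - c Gamma)^2 by
      (c1 - c2) Gamma (2 x - (c1 + c2) Gamma), and x is bounded by a constant
      depending only on kappa and on bounds for Gamma and p.
    - x + (c2 - c1) Gamma is a subsolution for c2 at the level
      l + sup |Gamma'| |c1 - c2|: the square does not change, and the derivative
      gains (c2 - c1) Gamma'.
    Hence the bifurcation value for c2 is at most that level
    ([lambda_hat_lip_on], [lambda_hat_lip_derive]); exchanging c1 and c2 gives
    the absolute value.

    A BPUC function is bounded and continuous off a countable set, and all that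
    is used of the coefficients is boundedness and continuity off a negligible
    set N ([tame], [BPUC_tame]).  Sub- and supersolutions are expressed by
    derivative-free slope bounds at the points outside N ([slope_le]); these pass
    to maxima and to limits, where derivatives may be lost.  The single
    measure-theoretic tool is [ac_nonincreasing]: an absolutely continuous
    function with nonpositive slopes off a negligible set is nonincreasing.

    The fact above is Perron's method ([perron_solution]): the supremum of all
    subsolutions with a common bound M and a common Lipschitz constant L inherits
    both, so it exists without any compactness argument; it is a subsolution, and
    if it grew too slowly somewhere, a bump could be added to one of the competing
    subsolutions ([admissible_bump]).

    That the bifurcation value exists also has to be shown, since it is defined
    by description ([lambda_starP]).  The set of good parameters l contains any
    upper bound of p (the zero function is a subsolution), is bounded below (below
    some level F <= -1 everywhere), and is upward closed (a solution for l is a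
    subsolution for larger parameters).  It contains its infimum: solutions for
    parameters decreasing to the infimum share their bound and Lipschitz constant
    ([bounded_solution_trapped]), and their lower limit is a subsolution
    ([subsolution_limit]). *)

(** * Absolutely continuous functions with nonpositive slopes *)

(** The one-sided bound is over intervals [u, v] that straddle t, so that it
    controls the function on both sides of t at once; it is the bound on all Dini
    derivatives at t by k, without asking for a derivative. *)
Definition slope_le {R : realType} (x : R -> R) (t k : R) : Prop :=
  forall e, 0 < e -> exists2 d, 0 < d &
    forall u v, t - d < u -> u <= t -> t <= v -> v < t + d ->
      x v - x u <= (k + e) * (v - u).

(** A finite family of nonoverlapping intervals of [a, t] whose interiors lie in
    U, listed from right to left.  A list rather than an indexed family, because
    the sweep in [ac_nonincreasing] adds intervals on the right one at a time. *)
Fixpoint chain {R : realType} (U : set R) (a t : R) (s : seq (R * R)) : Prop :=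
  if s is J :: s' then
    [/\ J.1 <= J.2, J.2 <= t, `]J.1, J.2[ `<=` U & chain U a J.1 s']
  else a <= t.

Lemma chain_le {R : realType} (U : set R) (a t : R) (s : seq (R * R)) :
  chain U a t s -> a <= t.
Proof. by elim: s t => //= J s IH t [? ? _ /IH]; lra. Qed.

Lemma chain_nth {R : realType} (U : set R) (a t : R) (s : seq (R * R)) (i : nat) :
  chain U a t s -> (i < size s)%N ->
  [/\ a <= (nth (0, 0) s i).1, (nth (0, 0) s i).1 <= (nth (0, 0) s i).2 &
      (nth (0, 0) s i).2 <= t].
Proof.
elim: s t i => //= J s IH t [|i] [J12 It _ ch] /= si.
  by split => //; exact: chain_le ch.
by have [? ? ?] := IH _ _ ch si; split => //; lra.
Qed.

Lemma chain_disjoint {R : realType} (U : set R) (a t : R) (s : seq (R * R))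
    (i j : nat) :
  chain U a t s -> (i < j)%N -> (j < size s)%N ->
  (nth (0, 0) s j).2 <= (nth (0, 0) s i).1.
Proof.
elim: s t i j => //= J s IH t i [//|j] [J12 It _ ch] /=; case: i => [|i] /= ij js.
  by have [] := chain_nth _ _ _ _ _ ch js.
exact: (IH _ i j ch ij js).
Qed.

Lemma chain_length {R : realType} (U : set R) (a t : R) (s : seq (R * R)) :
  measurable U -> chain U a t s ->
  ((\sum_(J <- s) (J.2 - J.1))%:E <= lebesgue_measure (U `&` `]-oo, t[))%E.
Proof.
move=> mU; elim: s t => [|J s IH] t /=; first by rewrite big_nil.
move=> [J12 It IU /IH {}IH]; rewrite big_cons EFinD.
have -> : (J.2 - J.1)%:E = lebesgue_measure `]J.1, J.2[%classic.
  rewrite lebesgue_measure_itv/= lte_fin; case: ltP => // ?.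
  by congr EFin; lra.
apply: (@le_trans _ _ (lebesgue_measure (`]J.1, J.2[%classic `|` (U `&` `]-oo, J.1[)))).
  rewrite measureU//.
  - by rewrite leeD2l.
  - exact: measurableI.
  - rewrite -subset0 => y [/=]; rewrite !in_itv/= => /andP[? _] [_].
    by rewrite ltNge => /negP; lra.
apply: le_measure; rewrite ?inE.
- by apply: measurableU => //; exact: measurableI.
- exact: measurableI.
- move=> y [yI|[Uy]] /=.
    by split; [exact: IU|move: yI; rewrite /= !in_itv/= => /andP[]; lra].
  by rewrite !in_itv/= => ?; split => //; lra.
Qed.

Lemma chain_variation {R : realType} (x : R -> R) (U : set R) (a b e d : R) :
  (forall (n : nat) (u v : 'I_n -> R),
      (forall i, a <= u i /\ u i <= v i /\ v i <= b) ->
      trivIset [set: 'I_n] (fun i => `]u i, v i[%classic) ->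
      \sum_(i < n) (v i - u i) < d ->
      \sum_(i < n) `|x (v i) - x (u i)| < e) ->
  measurable U -> (lebesgue_measure U < d%:E)%E ->
  forall s, chain U a b s -> \sum_(J <- s) `|x J.2 - x J.1| < e.
Proof.
move=> ac mU Ud s ch.
rewrite (big_nth (0, 0)) big_mkord; apply: ac.
- by move=> i; have [] := chain_nth _ _ _ _ _ ch (ltn_ord i).
- apply/trivIsetP => i j _ _ /eqP ij; rewrite -subset0 => y [/=].
  rewrite !in_itv/= => /andP[? ?] /andP[? ?].
  have : (i < j)%N || (j < i)%N by rewrite -neq_ltn; apply/eqP => /val_inj.
  case/orP => lt.
    by have := chain_disjoint _ _ _ _ _ _ ch lt (ltn_ord j); lra.
  by have := chain_disjoint _ _ _ _ _ _ ch lt (ltn_ord i); lra.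
- rewrite -(big_mkord xpredT (fun i => (nth (0, 0) s i).2 - (nth (0, 0) s i).1)).
  rewrite -(big_nth _ xpredT (fun J : R * R => J.2 - J.1)) -lte_fin.
  apply: le_lt_trans (chain_length _ _ _ _ mU ch) _.
  apply: le_lt_trans Ud; apply: le_measure; rewrite ?inE//.
  exact: measurableI.
Qed.

Lemma negligible_open_cover {R : realType} (N : set R) (d : R) :
  (@lebesgue_measure R).-negligible N -> 0 < d ->
  exists U : set R, [/\ open U, N `<=` U & (lebesgue_measure U < d%:E)%E].
Proof.
move=> [A [mA A0 NA]] d0.
have Aoo : (lebesgue_measure A < +oo)%E by rewrite A0.
have [U [oU AU UA]] := lebesgue_regularity_outer mA Aoo d0.
exists U; split => //; first exact: subset_trans AU.
apply: le_lt_trans UA.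
rewrite (measureDI lebesgue_measure (measurable_realfun.open_measurable oU) mA).
by rewrite (setIidr AU) [X in (_ + X)%E]A0 adde0.
Qed.

(** Cover N by an open set U of small measure and sweep from a to b.  Where the
    moving point lies outside U, the slope bound lets x grow at rate at most e;
    where it lies in U, a small interval of U is added to a chain, and the growth
    is charged to that interval.  By absolute continuity the total charge is at
    most e, since the intervals of the chain have total length below the measure
    of U. *)
Lemma ac_nonincreasing {R : realType} (x : R -> R) (a b : R) (N : set R) :
  a <= b -> abs_continuous_on a b x -> (@lebesgue_measure R).-negligible N ->
  (forall t, a <= t -> t <= b -> ~ N t -> slope_le x t 0) -> x b <= x a.
Proof.
move=> ab ac N0 sl; apply/ler_addgt0Pr => e0 e00.
pose e := e0 / (b - a + 1).
have e_gt0 : 0 < e by rewrite divr_gt0//; lra.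
have -> : e0 = e * (b - a) + e.
  by rewrite -[X in _ + X]mulr1 -mulrDr /e mulfVK//; apply/eqP; lra.
have [d d0 acd] := ac e e_gt0.
have [U [oU NU Ud]] := negligible_open_cover N d N0 d0.
have mU : measurable U by exact: measurable_realfun.open_measurable.
pose V s := \sum_(J <- s) `|x J.2 - x J.1|.
pose A := [set t | [/\ a <= t, t <= b &
  exists2 s, chain U a t s & x t - x a <= e * (t - a) + V s]].
have Aa : A a by split => //; exists [::] => //=; rewrite /V big_nil !subrr mulr0 addr0.
have hA : has_sup A.
  by split; [exists a|exists b => t []].
pose T := sup A.
have aT : a <= T by exact: ub_le_sup hA.2 _ Aa.
have Tb : T <= b by apply: ge_sup => [|t []]//; exists a.
have step g t r : A g -> g <= t -> t <= b -> 0 < r -> g <= T -> T <= t ->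
    T - r < g -> t < T + r ->
    (forall y, T - r < y -> y < T + r -> U y) \/
    (forall u v, T - r < u -> u <= T -> T <= v -> v < T + r ->
      x v - x u <= (0 + e) * (v - u)) -> A t.
  move=> [ag gb [s ch xg]] gt tb r0 gT Tt rg tr [rU|rs].
    split => //; first lra.
    exists ((g, t) :: s) => /=.
      by split => // y /=; rewrite in_itv/= => /andP[? ?]; apply: rU; lra.
    rewrite /V big_cons /= -/(V s).
    have := ler_norm (x t - x g); have : 0 <= e * (t - g) by rewrite mulr_ge0//; lra.
    by lra.
  split => //; first lra.
  exists s; first by case: s ch {xg} => /= [|J s [? ? ? ?]]; [lra|split => //; lra].
  by have := rs g t rg gT Tt tr; lra.
have [r r0 Ar] : exists2 r, 0 < r & (forall y, T - r < y -> y < T + r -> U y) \/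
    (forall u v, T - r < u -> u <= T -> T <= v -> v < T + r ->
      x v - x u <= (0 + e) * (v - u)).
  have [UT|UT] := pselect (U T).
    have /nbhs_ballP[r /= r0 rU] := open_nbhs_nbhs (conj oU UT).
    exists r => //; left => y y1 y2; apply: rU => /=.
    by rewrite /ball /= ltr_norml; apply/andP; split; lra.
  have [r r0 rs] := sl T aT Tb (fun h => UT (NU _ h)) _ e_gt0.
  by exists r => //; right.
have [g Ag Tg] := sup_adherent r0 hA.
have gT : g <= T by exact: ub_le_sup hA.2 _ Ag.
have AT : A T by apply: (step g T r) => //; lra.
have TB : T = b.
  apply/eqP; rewrite eq_le Tb /= leNgt; apply/negP => Tb'.
  pose t := Num.min b (T + r / 2).
  have tT : T < t by rewrite lt_min; apply/andP; split; lra.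
  have t1 : t <= b by rewrite ge_min lexx.
  have t2 : t <= T + r / 2 by rewrite ge_min lexx orbT.
  have At : A t by apply: (step T t r) => //; lra.
  by have := ub_le_sup hA.2 At; rewrite -/T; lra.
case: AT => _ _ [s]; rewrite TB => ch.
by have := chain_variation x U a b e d acd mU Ud s ch; rewrite -/(V s); lra.
Qed.

(** * Slopes, derivatives and Lipschitz functions *)

Lemma slope_le_weaken {R : realType} (x : R -> R) (t k k' : R) :
  k <= k' -> slope_le x t k -> slope_le x t k'.
Proof.
move=> kk' sl e e0; have [d d0 H] := sl e e0; exists d => // u v tu ut tv vt.
by apply: le_trans (H u v tu ut tv vt) _; rewrite ler_wpM2r//; lra.
Qed.

Lemma slope_le_one_sided {R : realType} (x : R -> R) (t k : R) :
  (forall e, 0 < e -> exists2 d, 0 < d & forall v, t <= v -> v < t + d ->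
     x v - x t <= (k + e) * (v - t)) ->
  (forall e, 0 < e -> exists2 d, 0 < d & forall u, t - d < u -> u <= t ->
     x t - x u <= (k + e) * (t - u)) ->
  slope_le x t k.
Proof.
move=> Hr Hl e e0; have [d d0 H] := Hr e e0; have [d' d'0 H'] := Hl e e0.
exists (Num.min d d'); first by rewrite lt_min d0.
have := ge_min d d d'; have := ge_min d' d d'; rewrite !lexx orbT /= => m1 m2.
move=> u v tu ut tv vt.
have h1 : x v - x t <= (k + e) * (v - t) by apply: H => //; lra.
have h2 : x t - x u <= (k + e) * (t - u) by apply: H' => //; lra.
by lra.
Qed.

Lemma is_derive_quotient {R : realType} (x : R -> R) (t k e : R) :
  is_derive t 1 x k -> 0 < e ->
  exists2 d, 0 < d & forall h, `|h| < d -> `|x (t + h) - x t - k * h| <= e * `|h|.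
Proof.
move=> [/cvg_ex[l hl] dx] e0.
have lk : l = k by rewrite -dx; apply/esym/cvg_lim.
move: hl; rewrite {}lk => /cvgrPdist_le /(_ e e0).
rewrite /dnbhs near_withinE => /nbhs_ballP[d /= d0 H].
exists d => // h hd; have [->|h0] := eqVneq h 0.
  by rewrite addr0 subrr mulr0 subr0 normr0 mulr0.
have := H h; rewrite /ball /= sub0r normrN => /(_ hd h0).
rewrite [h *: _]mulr1 (addrC h t) distrC => H'.
have -> : x (t + h) - x t - k * h = h * (h^-1 * (x (t + h) - x t) - k).
  by rewrite mulrBr mulVKf// (mulrC k).
by rewrite normrM mulrC ler_wpM2r.
Qed.

Lemma slope_le_derive {R : realType} (x : R -> R) (t k : R) :
  is_derive t 1 x k -> slope_le x t k.
Proof.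
move=> dx e e0; have [d d0 H] := is_derive_quotient x t k e dx e0.
exists d => // u v tu ut tv vt.
have hv : `|v - t| < d by rewrite ger0_norm; lra.
have hu : `|u - t| < d by rewrite ler0_norm; lra.
have := H _ hv; have := H _ hu.
have -> : t + (v - t) = v by lra.
have -> : t + (u - t) = u by lra.
rewrite (@ger0_norm _ (v - t)); last lra.
rewrite (@ler0_norm _ (u - t)); last lra.
by rewrite !ler_norml => /andP[? ?] /andP[? ?]; lra.
Qed.

(** Slope bounds from both sides by the same number give a derivative.  This is
    what turns the Perron supremum into a solution. *)
Lemma derive_of_slopes {R : realType} (x : R -> R) (t k : R) :
  slope_le x t k -> slope_le (fun s => - x s) t (- k) -> is_derive t 1 x k.
Proof.
move=> su sl.
have H : h^-1 *: ((x \o shift t) (h *: (1 : R)) - x t) @[h --> 0^'] --> k.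
  apply/cvgrPdist_le => e e0.
  have [d d0 H] := su e e0; have [d' d'0 H'] := sl e e0.
  rewrite /dnbhs near_withinE; apply/nbhs_ballP.
  exists (Num.min d d'); first by rewrite /= lt_min d0.
  move=> h; rewrite /ball /= sub0r normrN lt_min => /andP[hd hd'] h0.
  rewrite [h *: (1 : R)]mulr1 (addrC h t) distrC.
  have -> : h^-1 *: (x (t + h) - x t) - k = h^-1 * (x (t + h) - x t - k * h).
    by rewrite mulrBr (mulrC k) mulKf.
  rewrite normrM normfV ler_pdivrMl ?normr_gt0//.
  move: hd hd'; rewrite !ltr_norml => /andP[h1 h2] /andP[h3 h4].
  have [hp|hn] := lerP 0 h.
    rewrite (ger0_norm hp) ler_norml.
    have := H t (t + h); have := H' t (t + h).
    move=> /(_ ltac:(lra) ltac:(lra) ltac:(lra) ltac:(lra)) ?.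
    move=> /(_ ltac:(lra) ltac:(lra) ltac:(lra) ltac:(lra)) ?.
    by apply/andP; split; lra.
  rewrite (ltr0_norm hn) ler_norml.
  have := H (t + h) t; have := H' (t + h) t.
  move=> /(_ ltac:(lra) ltac:(lra) ltac:(lra) ltac:(lra)) ?.
  move=> /(_ ltac:(lra) ltac:(lra) ltac:(lra) ltac:(lra)) ?.
  by apply/andP; split; lra.
apply: DeriveDef; first by apply/cvg_ex; exists k.
exact: cvg_lim H.
Qed.

Definition lip {R : realType} (L : R) (x : R -> R) : Prop :=
  forall s t, s <= t -> `|x t - x s| <= L * (t - s).

Lemma lip_weaken {R : realType} (L L' : R) (x : R -> R) :
  L <= L' -> lip L x -> lip L' x.
Proof.
by move=> LL xL s t st; apply: le_trans (xL s t st) _; rewrite ler_wpM2r ?subr_ge0.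
Qed.

Lemma lip_abs_continuous {R : realType} (L : R) (x : R -> R) (a b : R) :
  lip L x -> abs_continuous_on a b x.
Proof.
move=> xL e e0; have L0 : 0 < `|L| + 1 by have := normr_ge0 L; lra.
exists (e / (`|L| + 1)); first exact: divr_gt0.
move=> n u v uv _; rewrite ltr_pdivlMr// => Hs.
apply: le_lt_trans Hs; rewrite mulr_suml; apply: ler_sum => i _.
have [_ [ui _]] := uv i; apply: le_trans (xL _ _ ui) _.
by rewrite mulrC ler_wpM2l//; have := ler_norm L; lra.
Qed.

Lemma abs_continuous_subZ {R : realType} (x : R -> R) (k a b : R) :
  abs_continuous_on a b x -> abs_continuous_on a b (fun t => x t - k * t).
Proof.
move=> ac e e0; have e20 : 0 < e / 2 by lra.
have [d d0 H] := ac _ e20.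
have kac : abs_continuous_on a b (fun t => k * t).
  apply: (@lip_abs_continuous _ `|k|) => s t st.
  by rewrite -mulrBr normrM (@ger0_norm _ (t - s)) ?subr_ge0.
have [d' d'0 H'] := kac _ e20.
exists (Num.min d d'); first by rewrite lt_min d0.
move=> n u v uv tr; rewrite lt_min => /andP[h1 h2].
have := H n u v uv tr h1; have := H' n u v uv tr h2 => a1 a2.
apply: (@le_lt_trans _ _ (\sum_(i < n) `|x (v i) - x (u i)| +
  \sum_(i < n) `|k * v i - k * u i|)); last lra.
rewrite -big_split /=; apply: ler_sum => i _.
have -> : x (v i) - k * v i - (x (u i) - k * u i) =
  (x (v i) - x (u i)) - (k * v i - k * u i) by lra.
exact: ler_normB.
Qed.

(** A pointwise differential inequality off a negligible set integrates; this is
    how every such inequality below is used. *)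
Lemma slope_le_increment {R : realType} (x : R -> R) (a b k : R) (N : set R) :
  a <= b -> abs_continuous_on a b x -> (@lebesgue_measure R).-negligible N ->
  (forall t, a <= t -> t <= b -> ~ N t -> slope_le x t k) ->
  x b - x a <= k * (b - a).
Proof.
move=> ab ac N0 H.
suff : x b - k * b <= x a - k * a by lra.
apply: (@ac_nonincreasing R (fun t => x t - k * t) a b N) => //.
  exact: abs_continuous_subZ.
move=> t ta tb tN e e0; have [d d0 {}H] := H t ta tb tN e e0.
by exists d => // u v h1 h2 h3 h4; have := H u v h1 h2 h3 h4; lra.
Qed.

(** * Subsolutions *)

Definition subsolution {R : realType} (F : R -> R -> R) (N : set R) (u : R -> R)
    : Prop :=
  forall t, ~ N t -> slope_le u t (F t (u t)).

Definition continuous_off {R : realType} (N : set R) (F : R -> R -> R) : Prop :=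
  forall t, ~ N t -> forall y e, 0 < e -> exists2 d, 0 < d &
    forall t' y', `|t' - t| < d -> `|y' - y| < d -> `|F t' y' - F t y| < e.

Lemma subsolution_weaken {R : realType} (F G : R -> R -> R) (N : set R) (u : R -> R) :
  subsolution F N u -> (forall t, F t (u t) <= G t (u t)) -> subsolution G N u.
Proof. by move=> su FG t tN; apply: slope_le_weaken (su t tN). Qed.

(** One closure principle for suprema, infima and lower limits of subsolutions:
    on each interval [a, b], the growth of X is that of a subsolution u up to th.
    Near a point t outside N, continuity of F and the common Lipschitz constant
    keep F(r, u r) close to F(t, X t) along [a, b], so u, and with it X, grows at
    most at rate F(t, X t) + e. *)
Lemma subsolution_approx {R : realType} (F : R -> R -> R) (N : set R) (L : R)
    (X : R -> R) :
  (@lebesgue_measure R).-negligible N -> continuous_off N F -> 0 <= L -> lip L X ->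
  (forall a b th, a < b -> 0 < th -> exists u,
     [/\ lip L u, subsolution (fun t y => F t y + th) N u,
         X b - th <= u b & u a <= X a + th]) ->
  subsolution F N X.
Proof.
move=> N0 cF L0 XL H t tN e e0; set K := F t (X t).
have e20 : 0 < e / 2 by lra.
have [d d0 Hd] := cF t tN (X t) _ e20.
pose d' := d / (14 * (L + 1)).
have dd' : d = d' * (14 * (L + 1)) by rewrite /d' divfK//; apply/eqP; lra.
have d'0 : 0 < d' by rewrite divr_gt0//; lra.
have Ld' : 0 <= L * d' by rewrite mulr_ge0// ltW.
exists d' => // a b ta ut tb bt.
have : a <= b by lra.
rewrite le_eqVlt => /orP[/eqP ->|ab]; first by rewrite !subrr mulr0.
pose th := Num.min (d / 4) (Num.min (e / 4) (e * (b - a) / 8)).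
have th0 : 0 < th by rewrite !lt_min !divr_gt0 ?mulr_gt0//; lra.
have th1 : th <= d / 4 by rewrite ge_min lexx.
have th2 : th <= e / 4 by rewrite !ge_min lexx orbT.
have th3 : th <= e * (b - a) / 8 by rewrite !ge_min lexx !orbT.
have [u [uL su ub ua]] := H a b th ab th0.
have inc : u b - u a <= (K + e / 2 + th) * (b - a).
  apply: (slope_le_increment u a b _ N) => //; first by lra.
    exact: lip_abs_continuous uL.
  move=> r ra rb rN; apply: slope_le_weaken (su r rN).
  suff : `|F r (u r) - F t (X t)| < e / 2.
    by rewrite ltr_norml -/K => /andP[_ ?]; lra.
  have Lm (p q : R) : p <= q -> q - p < 2 * d' -> L * (q - p) <= 2 * (L * d').
    by move=> pq qp; rewrite mulrCA; apply: ler_wpM2l => //; lra.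
  apply: Hd; first by rewrite ltr_norml; apply/andP; split; lra.
  have /ler_normlP[h1 h2] := uL a r ra.
  have /ler_normlP[h3 h4] := uL a b (ltW ab).
  have /ler_normlP[h5 h6] := XL a b (ltW ab).
  have /ler_normlP[h7 h8] := XL a t ut.
  have := Lm a r ra ltac:(lra); have := Lm a b (ltW ab) ltac:(lra).
  have := Lm a t ut ltac:(lra) => g1 g2 g3.
  rewrite ltr_norml; apply/andP; split; lra.
have : th * (b - a) <= (e / 4) * (b - a) by rewrite ler_wpM2r//; lra.
by lra.
Qed.

Lemma lip_max {R : realType} (L : R) (u v : R -> R) :
  lip L u -> lip L v -> lip L (fun t => Num.max (u t) (v t)).
Proof.
move=> uL vL s t st; have /ler_normlP[h1 h2] := uL s t st.
have /ler_normlP[h3 h4] := vL s t st.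
by case: (lerP (u t) (v t)) => ?; case: (lerP (u s) (v s)) => ?;
  rewrite ler_norml; apply/andP; split; lra.
Qed.

Lemma lip_min {R : realType} (L : R) (u v : R -> R) :
  lip L u -> lip L v -> lip L (fun t => Num.min (u t) (v t)).
Proof.
move=> uL vL s t st; have /ler_normlP[h1 h2] := uL s t st.
have /ler_normlP[h3 h4] := vL s t st.
by case: (lerP (u t) (v t)) => ?; case: (lerP (u s) (v s)) => ?;
  rewrite ler_norml; apply/andP; split; lra.
Qed.

Lemma lip_affine {R : realType} (L c m s : R) :
  `|m| <= L -> lip L (fun t => c + m * (t - s)).
Proof.
move=> mL a b ab.
have -> : c + m * (b - s) - (c + m * (a - s)) = m * (b - a) by lra.
by rewrite normrM (@ger0_norm _ (b - a)) ?subr_ge0// ler_wpM2r ?subr_ge0.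
Qed.

Lemma slope_le_max {R : realType} (u v : R -> R) (t k : R) :
  slope_le u t k -> slope_le v t k -> slope_le (fun s => Num.max (u s) (v s)) t k.
Proof.
move=> su sv e e0; have [d d0 H] := su e e0; have [d' d'0 H'] := sv e e0.
exists (Num.min d d'); first by rewrite lt_min d0.
move=> a b; have := @ge_min _ _ d d d'; have := @ge_min _ _ d' d d'.
rewrite !lexx orbT /= => m1 m2 ta ut tb bt.
have h1 : u b - u a <= (k + e) * (b - a) by apply: H => //; lra.
have h2 : v b - v a <= (k + e) * (b - a) by apply: H' => //; lra.
have : u a <= Num.max (u a) (v a) by rewrite le_max lexx.
have : v a <= Num.max (u a) (v a) by rewrite le_max lexx orbT.
by case: (lerP (u b) (v b)) => ?; lra.
Qed.

Lemma slope_le_near {R : realType} (u v : R -> R) (t k r : R) :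
  0 < r -> (forall s, t - r < s -> s < t + r -> u s = v s) ->
  slope_le u t k -> slope_le v t k.
Proof.
move=> r0 uv su e e0; have [d d0 H] := su e e0.
exists (Num.min d r); first by rewrite lt_min d0.
move=> a b; have := @ge_min _ _ d d r; have := @ge_min _ _ r d r.
rewrite !lexx orbT /= => m1 m2 ta ut tb bt.
rewrite -!uv; [|lra..]; apply: H => //; lra.
Qed.

Lemma slope_le_max_gt {R : realType} (L : R) (u v : R -> R) (t k : R) :
  0 <= L -> lip L u -> lip L v -> v t < u t -> slope_le u t k ->
  slope_le (fun s => Num.max (u s) (v s)) t k.
Proof.
move=> L0 uL vL vu; pose r := (u t - v t) / (2 * (L + 1)).
have rE : u t - v t = r * (2 * (L + 1)) by rewrite /r divfK//; apply/eqP; lra.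
have r0 : 0 < r by rewrite divr_gt0//; lra.
apply: (slope_le_near _ _ _ _ r r0) => s ts st; apply/esym/max_idPl.
have [sr|sr] := lerP s t.
  have /ler_normlP[h1 h2] := uL s t sr; have /ler_normlP[h3 h4] := vL s t sr.
  by have : L * (t - s) <= L * r by [apply: ler_wpM2l => //; lra]; lra.
have /ler_normlP[h1 h2] := uL t s (ltW sr); have /ler_normlP[h3 h4] := vL t s (ltW sr).
by have : L * (s - t) <= L * r by [apply: ler_wpM2l => //; lra]; lra.
Qed.

(** * Perron's method *)

Definition admissible {R : realType} (F : R -> R -> R) (N : set R) (L M : R)
    (u : R -> R) : Prop :=
  [/\ lip L u, forall t, `|u t| <= M & subsolution F N u].

(** A concave broken line with slopes L, m and - L and corners at s and b, equal
    to c at s.  The steep outer pieces keep it below an L-Lipschitz function with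
    value c at s for all times up to s, and have slope - L <= F after b. *)
Definition bump {R : realType} (c s b m L : R) (t : R) : R :=
  Num.min (c + L * (t - s))
    (Num.min (c + m * (t - s)) (c + m * (b - s) + - L * (t - b))).

Lemma bumpP {R : realType} (c s b m L t : R) : `|m| <= L -> s <= b ->
  [/\ t <= s -> bump c s b m L t = c + L * (t - s),
      s <= t -> t <= b -> bump c s b m L t = c + m * (t - s) &
      b <= t -> bump c s b m L t = c + m * (b - s) - L * (t - b)].
Proof.
rewrite ler_norml => /andP[m1 m2] sb; split.
- move=> ts; apply/min_idPl; rewrite le_min.
  have h1 : m * (s - t) <= L * (s - t) by rewrite ler_wpM2r//; lra.
  have h2 : (- L) * (b - s) <= m * (b - s) by rewrite ler_wpM2r//; lra.
  have h3 : 0 <= L * (s - t) by rewrite mulr_ge0//; lra.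
  by apply/andP; split; lra.
- move=> st tb.
  have h1 : m * (t - s) <= L * (t - s) by rewrite ler_wpM2r//; lra.
  have h2 : (- L) * (b - t) <= m * (b - t) by rewrite ler_wpM2r//; lra.
  rewrite /bump; have -> : Num.min (c + m * (t - s))
    (c + m * (b - s) + - L * (t - b)) = c + m * (t - s).
    by apply/min_idPl; lra.
  by apply/min_idPr; lra.
- move=> bt.
  have h1 : m * (b - s) <= L * (b - s) by rewrite ler_wpM2r//; lra.
  have h2 : (- L) * (t - b) <= m * (t - b) by rewrite ler_wpM2r//; lra.
  have h3 : 0 <= L * (t - b) by rewrite mulr_ge0//; lra.
  rewrite /bump; have -> : Num.min (c + m * (t - s))
    (c + m * (b - s) + - L * (t - b)) = c + m * (b - s) - L * (t - b).
    by rewrite mulNr; apply/min_idPr; lra.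
  by apply/min_idPr; lra.
Qed.

Lemma lip_bump {R : realType} (c s b m L : R) : `|m| <= L -> lip L (bump c s b m L).
Proof.
move=> mL; have L0 : 0 <= L := le_trans (normr_ge0 m) mL.
apply: lip_min; first by apply: lip_affine; rewrite ger0_norm.
by apply: lip_min; apply: lip_affine => //; rewrite normrN ger0_norm.
Qed.

(** If m is below F along the segment of slope m that starts on the graph of u, the
    maximum of u and the bump is again admissible.  Before s it is u; where the
    bump is on top, its slope is m <= F on [s, b] and - L <= F after b. *)
Lemma admissible_bump {R : realType} (F : R -> R -> R) (N : set R) (L M : R)
    (u : R -> R) (s b m : R) :
  (forall t y, `|y| <= M -> `|F t y| <= L) ->
  admissible F N L M u -> s <= b -> `|m| <= L -> u s + m * (b - s) <= M ->
  (forall t, s <= t -> t <= b -> m <= F t (u s + m * (t - s))) ->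
  exists2 v, admissible F N L M v & u s + m * (b - s) <= v b.
Proof.
move=> FL [uL uM su] sb mL bM mF; have L0 : 0 <= L := le_trans (normr_ge0 m) mL.
have /andP[m1 m2] : - L <= m <= L by rewrite -ler_norml.
set l := bump (u s) s b m L.
have lP t := bumpP (u s) s b m L t mL sb.
have lL : lip L l by exact: lip_bump.
have lslope a c : s <= a -> a <= c -> l c - l a <= m * (c - a).
  move=> sa ac; have [_ la1 la2] := lP a; have [_ lc1 lc2] := lP c.
  have h1 : (- L) * (c - a) <= m * (c - a) by rewrite ler_wpM2r//; lra.
  have [ab|ba] := lerP a b.
    have [cb|bc] := lerP c b; first by rewrite /l la1// lc1//; lra.
    have h2 : (- L) * (c - b) <= m * (c - b) by rewrite ler_wpM2r//; lra.
    by rewrite /l la1// lc2//; lra.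
  by rewrite /l la2 ?lc2//; lra.
have luM t : l t <= M.
  clear lslope lL uL su FL mF.
  have [l1 l2 l3] := lP t; have := uM s; rewrite ler_norml => /andP[_ usM].
  have [ts|st] := lerP t s.
    have h : 0 <= L * (s - t) by rewrite mulr_ge0//; lra.
    by rewrite /l l1//; lra.
  have [tb|bt] := lerP t b.
    rewrite /l l2//; last exact: ltW.
    have [m0|m0] := lerP 0 m.
      have h : 0 <= m * (b - t) by rewrite mulr_ge0//; lra.
      by lra.
    have h : 0 <= (- m) * (t - s) by rewrite mulr_ge0//; lra.
    by lra.
  have h : 0 <= L * (t - b) by rewrite mulr_ge0//; lra.
  by rewrite /l l3//; lra.
have lu t : t <= s -> l t <= u t.
  move=> ts; have [l1 _ _] := lP t; rewrite /l l1//.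
  by have := uL t s ts; rewrite ler_norml => /andP[_ ?]; lra.
pose v t := Num.max (u t) (l t).
have vL : lip L v by exact: lip_max.
have vM t : `|v t| <= M.
  have := uM t; have := luM t; rewrite /v !ler_norml => lM /andP[? ?].
  by clear m1 m2 sb bM L0; case: (lerP (u t) (l t)) => ?; apply/andP; split; lra.
exists v; last first.
  rewrite /v le_max; apply/orP; right.
  by have [_ l2 _] := lP b; rewrite /l l2.
split => // t tN.
have [lt|ul] := ltrP (l t) (u t).
  have vt : v t = u t by apply/max_idPl; exact: ltW.
  by rewrite vt; exact: (slope_le_max_gt L _ _ _ _ L0 uL lL lt (su t tN)).
have vt : v t = l t by apply/max_idPr.
have Fm : s <= t -> t <= b -> m <= F t (v t).
  move=> st tb; rewrite vt; have [_ l2 _] := lP t.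
  by rewrite /l l2//; apply: mF.
have FL' : - L <= F t (v t).
  by have := FL t _ (vM t); rewrite ler_norml => /andP[].
have [st|ts] := ltrP s t; last first.
  (* Up to s, v agrees with u; only at s itself does the bump matter, on the right,
     where its slope is m. *)
  have ut : u t = l t by have := lu t ts; lra.
  have vut : v t = u t by rewrite vt.
  have sut := su t tN; rewrite -vut in sut.
  apply: slope_le_one_sided => e e0; have [d d0 H] := sut e e0;
    have [td dt] : t - d < t /\ t < t + d by (clear -d0; split; lra).
    have [ts'|st'] := ltrP t s.
      exists (Num.min d (s - t)); first by rewrite lt_min d0 subr_gt0.
      move=> w tw; have := @ge_min _ _ d d (s - t); have := @ge_min _ _ (s - t) d (s - t).
      rewrite !lexx orbT /= => g1 g2 wt.
      have -> : v w = u w by apply/max_idPl; apply: lu; lra.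
      have wd : w < t + d by clear -wt g2; lra.
      by have := H t w td (lexx _) tw wd; rewrite vut; clear; lra.
    have ts2 : t = s by apply/eqP; rewrite eq_le ts.
    exists d => // w tw wt; rewrite {1}/v.
    case: (lerP (u w) (l w)) => _; last first.
      by have := H t w td (lexx _) tw wt; rewrite vut; clear; lra.
    have := Fm st' (le_trans ts sb); rewrite vt => Fm'.
    apply: le_trans (lslope _ _ st' tw) _.
    by rewrite ler_wpM2r ?subr_ge0//; clear -Fm' e0; lra.
  exists d => // w tw wt; rewrite vut.
  have : u w <= v w by rewrite le_max lexx.
  by have := H w t tw wt (lexx _) dt; rewrite vut; clear; lra.
have sl : slope_le l t (F t (v t)).
  move=> e e0; have [tb|bt] := lerP t b.
    exists (t - s); first lra.
    move=> a c ta at' tc _; have ac : a <= c := le_trans at' tc.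
    have : l c - l a <= m * (c - a) by apply: lslope => //; clear -ta; lra.
    move/le_trans; apply; rewrite ler_wpM2r ?subr_ge0//.
    by have := Fm (ltW st) tb; clear -e0; lra.
  exists (t - b); first lra.
  move=> a c ta at' tc _; have [_ _ la] := lP a; have [_ _ lc] := lP c.
  have ac : a <= c := le_trans at' tc.
  have ba : b <= a by clear -ta; lra.
  have -> : l c - l a = (- L) * (c - a).
    by rewrite /l (la ba) (lc (le_trans ba ac)); clear; lra.
  by rewrite ler_wpM2r ?subr_ge0//; clear -FL' e0; lra.
move: ul; rewrite le_eqVlt => /orP[/eqP ul|ul].
  apply: slope_le_max sl; have -> : v t = u t by rewrite vt.
  exact: su.
rewrite /v; have -> : (fun t => Num.max (u t) (l t)) = (fun t => Num.max (l t) (u t)).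
  by apply/funext => r; rewrite maxC.
exact: (slope_le_max_gt L _ _ _ _ L0 lL uL ul sl).
Qed.

(** The supremum X of the admissible functions is a subsolution by
    [subsolution_approx].  Were its growth near t slower than K - e, with
    K = F(t, X t), a bump of slope K - e placed on an admissible function that
    nearly attains X would rise above X.  The hypothesis F(t, M) <= 0 keeps the
    bump below M: a rising bump is only needed where X t < M, and there is room
    for a short one. *)
Lemma perron_solution {R : realType} (F : R -> R -> R) (N : set R) (L M : R)
    (w : R -> R) :
  (@lebesgue_measure R).-negligible N -> continuous_off N F ->
  (forall t y, `|y| <= M -> `|F t y| + 1 <= L) -> (forall t, F t M <= 0) ->
  admissible F N L M w ->
  exists X, [/\ lip L X, forall t, `|X t| <= M &
    forall t, ~ N t -> is_derive t 1 X (F t (X t))].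
Proof.
move=> N0 cF FL FM aw.
pose S t := [set y | exists2 u, admissible F N L M u & y = u t].
have M0 : 0 <= M by have [_ /(_ 0) h _] := aw; apply: le_trans h.
have L1 : 1 <= L.
  by have := FL 0 0; rewrite normr0 => /(_ M0); have := normr_ge0 (F 0 0); lra.
have L0 : 0 <= L by lra.
have S0 t : S t !=set0 by exists (w t), w.
have Sb t : has_ubound (S t).
  by exists M => _ [u [_ uM _] ->]; have := uM t; rewrite ler_norml => /andP[].
have hS t : has_sup (S t) by [].
pose X t := sup (S t).
have uX u t : admissible F N L M u -> u t <= X t.
  by move=> au; apply: ub_le_sup => //; exists u.
have Xu t th : 0 < th -> exists2 u, admissible F N L M u & X t - th < u t.
  by move=> th0; have [_ [u au ->] h] := sup_adherent th0 (hS t); exists u.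
have XM t : `|X t| <= M.
  rewrite ler_norml; apply/andP; split.
    have := uX w t aw; have [_ /(_ t) h _] := aw.
    by move: h; rewrite ler_norml => /andP[]; lra.
  by apply: ge_sup => // _ [u [_ uM _] ->]; have := uM t; rewrite ler_norml => /andP[].
have XL : lip L X.
  move=> s t st; rewrite ler_norml; apply/andP; split.
    apply/ler_addgt0Pr => th th0; have [u au us] := Xu s th th0.
    have := uX u t au; case: (au) => uL _ _; have := uL s t st.
    by rewrite ler_norml => /andP[]; lra.
  apply/ler_addgt0Pr => th th0; have [u au ut] := Xu t th th0.
  have := uX u s au; case: (au) => uL _ _; have := uL s t st.
  by rewrite ler_norml => /andP[]; lra.
have sX : subsolution F N X.
  apply: (subsolution_approx _ _ L) => // a b th ab th0.
  have [u au ub] := Xu b th th0; exists u; have ua := uX u a au.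
  case: au => uL uM su; split => //; [|exact: ltW|lra].
  by apply: subsolution_weaken su _ => t; lra.
exists X; split => // t tN; apply: derive_of_slopes; first exact: sX.
clearbody X; clear S S0 Sb hS sX aw N0 w.
set K := F t (X t) => e e0.
pose e1 := Num.min e 1.
have e10 : 0 < e1 by rewrite lt_min e0 ltr01.
have e1e : e1 <= e by rewrite ge_min lexx.
have e11 : e1 <= 1 by rewrite ge_min lexx orbT.
have := FL t _ (XM t); rewrite -/K => KL.
have /andP[K1 K2] : - (L - 1) <= K <= L - 1 by rewrite -ler_norml; lra.
have [d d0 Hd] := cF t tN (X t) _ e10.
have [rho rho0 Hrho] : exists2 rho, 0 < rho & X t < M -> rho <= M - X t.
  have [XtM|] := ltrP (X t) M; first by exists (M - X t) => //; lra.
  by exists 1.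
pose d1 := Num.min d rho.
have d10 : 0 < d1 by rewrite lt_min d0.
have d1d : d1 <= d by rewrite ge_min lexx.
have d1r : d1 <= rho by rewrite ge_min lexx orbT.
pose d' := d1 / (6 * (L + 1)).
have dd' : d1 = d' * (6 * (L + 1)) by rewrite /d' divfK//; apply/eqP; lra.
have d'0 : 0 < d' by rewrite divr_gt0//; lra.
have Ld' : 0 <= L * d' by rewrite mulr_ge0// ltW.
exists d' => // a b ta at' tb bt.
have ab : a <= b by lra.
clearbody e1 d1 d'.
have [m mE] : exists m, m = K - e1 by exists (K - e1).
have mL : `|m| <= L by rewrite ler_norml; apply/andP; split; lra.
suff inc : m * (b - a) <= X b - X a.
  have : (K - e) * (b - a) <= m * (b - a).
    by rewrite ler_wpM2r ?subr_ge0//; clear -e1e mE; lra.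
  by clear -inc; lra.
have d'd : d' <= d by clear -d1d dd' d'0 L0 Ld'; lra.
clear K1 K2 KL e11 e1e rho0 d0 e0 L1.
apply/ler_addgt0Pr => th2 th20.
pose th := Num.min th2 (d1 / 4).
have th0 : 0 < th by rewrite lt_min th20 divr_gt0.
have thth2 : th <= th2 by rewrite ge_min lexx.
have thd1 : th <= d1 / 4 by rewrite ge_min lexx orbT.
have [u au ua] := Xu a th th0.
have uaX := uX u a au.
have close r : a <= r -> r <= b -> `|u a + m * (r - a) - X t| < d1.
  move=> ar rb; have := XL a t at'; rewrite ler_norml => /andP[x1 x2].
  have h1 : L * (t - a) <= L * d' by apply: ler_wpM2l => //; clear -ta; lra.
  have h2 : L * (r - a) <= L * (2 * d').
    by apply: ler_wpM2l => //; clear -ta bt rb; lra.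
  have : `|m * (r - a)| <= L * (r - a).
    by rewrite normrM (@ger0_norm _ (r - a)) ?subr_ge0// ler_wpM2r// subr_ge0.
  rewrite ler_norml => /andP[? ?]; rewrite ltr_norml.
  by clear Hrho mE ab; apply/andP; split; lra.
have [|||v av vb] := admissible_bump F N L M u a b m _ au ab mL.
- by move=> r y yM; have := FL r y yM; clear; lra.
- have [m0|m0] := lerP m 0.
    have : 0 <= (- m) * (b - a) by rewrite mulr_ge0 ?oppr_ge0 ?subr_ge0.
    by case: au => _ /(_ a) + _; rewrite ler_norml; clear => /andP[]; lra.
  have XtM : X t < M.
    rewrite lt_neqAle; have := XM t; rewrite ler_norml => /andP[_ ->]; rewrite andbT.
    by apply/eqP => XtM; have := FM t; rewrite -XtM -/K; clear -m0 mE e10; lra.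
  have := close b ab (lexx _); rewrite ltr_norml => /andP[_ h].
  by have := Hrho XtM; clear -h d1r; lra.
- move=> r ar rb; have : `|F r (u a + m * (r - a)) - F t (X t)| < e1.
    apply: Hd.
      by clear -ta at' tb bt ar rb d'd; rewrite ltr_norml; apply/andP; split; lra.
    by apply: lt_le_trans (close r ar rb) _.
  by rewrite ltr_norml -/K => /andP[h _]; clear -h mE; lra.
by have := uX v b av; clear -vb ua thth2; lra.
Qed.

(** * Bounded solutions: limits, regularity and bounds *)

(** The limit is X t = sup_(th > 0) inf_x (x t), the infimum being over the
    functions admissible for F + th: the lower limit as th tends to 0.  These
    infima increase as th decreases, so on [a, b] one function x can be found that
    is almost above X at b and almost below X at a; this gives the Lipschitz
    constant, the bound and, by [subsolution_approx], the subsolution property. *)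
Lemma subsolution_limit {R : realType} (F : R -> R -> R) (N : set R) (L M : R) :
  (@lebesgue_measure R).-negligible N -> continuous_off N F -> 0 <= L ->
  (forall th, 0 < th -> exists x, admissible (fun t y => F t y + th) N L M x) ->
  exists X, admissible F N L M X.
Proof.
move=> N0 cF L0 ex.
pose I th t := [set y | exists2 x, admissible (fun t y => F t y + th) N L M x & y = x t].
have In0 th t : 0 < th -> I th t !=set0.
  by move=> th0; have [x ax] := ex th th0; exists (x t), x.
have Il th t : has_lbound (I th t).
  exists (- M) => _ [x [_ /(_ t) xM _] ->].
  by move: xM; rewrite ler_norml => /andP[].
pose Y th t := inf (I th t).
have Yx th t x : admissible (fun t y => F t y + th) N L M x -> Y th t <= x t.
  by move=> ax; apply: ge_inf => //; exists x.
have YM th t : 0 < th -> - M <= Y th t <= M.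
  move=> th0; have [x ax] := ex th th0; apply/andP; split.
    apply: lb_le_inf; first exact: In0.
    by move=> _ [z [_ /(_ t) zM _] ->]; move: zM; rewrite ler_norml => /andP[].
  have := Yx th t x ax; case: ax => _ /(_ t) + _; rewrite ler_norml => /andP[]; lra.
pose J t := [set y | exists2 th, 0 < th & y = Y th t].
have hJ t : has_sup (J t).
  split; first by exists (Y 1 t), 1.
  by exists M => _ [th th0 ->]; have /andP[] := YM th t th0.
pose X t := sup (J t).
have YX th t : 0 < th -> Y th t <= X t.
  by move=> th0; apply: ub_le_sup; [exact: (hJ t).2|exists th].
have approx a b th : 0 < th -> exists x,
    [/\ admissible (fun t y => F t y + th) N L M x, X b - th <= x b & x a <= X a + th].
  move=> th0; have [_ [eta eta0 ->] Xb] := sup_adherent th0 (hJ b).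
  pose ze := Num.min eta th.
  have ze0 : 0 < ze by rewrite lt_min eta0.
  have zeth : ze <= th by rewrite ge_min lexx orbT.
  have zeeta : ze <= eta by rewrite ge_min lexx.
  have hI : has_inf (I ze a) by split; [exact: In0|].
  have [_ [x ax ->] xa] := inf_adherent th0 hI.
  have wk z : ze <= z -> admissible (fun t y => F t y + z) N L M x.
    by case: ax => xL xM sx zez; split => //; apply: subsolution_weaken sx _ => t; lra.
  exists x; split; first exact: wk.
    by have := Yx eta b x (wk _ zeeta); rewrite -/(X b) in Xb; lra.
  by have := YX ze a ze0; rewrite -/(Y ze a) in xa; lra.
have XL : lip L X.
  move=> s t st; rewrite ler_norml; apply/andP; split; apply/ler_addgt0Pr => th th0.
    have th20 : 0 < th / 2 by lra.
    have [x [[xL _ _] h1 h2]] := approx t s _ th20.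
    by have := xL s t st; rewrite ler_norml => /andP[]; lra.
  have th20 : 0 < th / 2 by lra.
  have [x [[xL _ _] h1 h2]] := approx s t _ th20.
  by have := xL s t st; rewrite ler_norml => /andP[]; lra.
exists X; split => // [t|].
  rewrite ler_norml; apply/andP; split; apply/ler_addgt0Pr => th th0.
    have [x [[_ /(_ t) xM _] h1 h2]] := approx t t _ th0.
    by move: xM; rewrite ler_norml => /andP[]; lra.
  have [x [[_ /(_ t) xM _] h1 h2]] := approx t t _ th0.
  by move: xM; rewrite ler_norml => /andP[]; lra.
apply: (subsolution_approx _ _ L) => // a b th _ th0.
by have [x [[xL _ sx] h1 h2]] := approx a b th th0; exists x.
Qed.

Lemma lip_solution_caratheodory {R : realType} (F : R -> R -> R) (N : set R) (L : R)
    (x : R -> R) :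
  (@lebesgue_measure R).-negligible N -> lip L x ->
  (forall t, ~ N t -> is_derive t 1 x (F t (x t))) -> caratheodory_solution F x.
Proof.
move=> N0 xL dx; split=> [a b _|]; first exact: lip_abs_continuous xL.
apply: negligibleS N0 => t /= H; apply: contrapT => tN; apply: H; exact: dx.
Qed.

Lemma abs_continuousN {R : realType} (x : R -> R) (a b : R) :
  abs_continuous_on a b x -> abs_continuous_on a b (fun t => - x t).
Proof.
move=> ac e e0; have [d d0 H] := ac e e0; exists d => // n u v uv tr uvd.
by under eq_bigr => i _ do rewrite -opprD normrN; exact: H.
Qed.

(** A bounded solution, a priori differentiable only almost everywhere, is
    differentiable wherever F is continuous: integrating the equation over short
    intervals around such a t bounds the slopes of x at t from both sides by
    F(t, x t). *)
Lemma caratheodory_solution_lip {R : realType} (F : R -> R -> R) (N : set R)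
    (L B : R) (x : R -> R) :
  continuous_off N F -> caratheodory_solution F x -> (forall t, `|x t| <= B) ->
  (forall t y, `|y| <= B -> `|F t y| <= L) ->
  lip L x /\ forall t, ~ N t -> is_derive t 1 x (F t (x t)).
Proof.
move=> cF [ac ae] xB FL.
have {}ae : (@lebesgue_measure R).-negligible
  [set t : R | ~ is_derive t 1 x (F t (x t))] by [].
set E := [set t | _] in ae.
have dE t : ~ E t -> is_derive t 1 x (F t (x t)) by move/contrapT.
have inc a b k : a <= b -> (forall t, a <= t -> t <= b -> F t (x t) <= k) ->
    x b - x a <= k * (b - a).
  move=> ab Fk; apply: (slope_le_increment x a b k E ab (ac a b ab) ae) => t ta tb tE.
  by apply: slope_le_weaken (Fk t ta tb) _; apply: slope_le_derive; exact: dE.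
have dec a b k : a <= b -> (forall t, a <= t -> t <= b -> k <= F t (x t)) ->
    k * (b - a) <= x b - x a.
  move=> ab Fk; suff : (- x b) - (- x a) <= (- k) * (b - a) by lra.
  apply: (slope_le_increment (fun t => - x t) a b (- k) E ab) => //.
    exact: abs_continuousN (ac a b ab).
  move=> t ta tb tE; apply: (@slope_le_weaken _ _ _ (- F t (x t))).
    by rewrite lerN2; exact: Fk.
  by apply: slope_le_derive; apply: is_deriveN; exact: dE.
have xL : lip L x.
  move=> s t st; rewrite ler_norml -mulNr; apply/andP; split.
    by apply: dec => // r _ _; have := FL r _ (xB r); rewrite ler_norml => /andP[].
  by apply: inc => // r _ _; have := FL r _ (xB r); rewrite ler_norml => /andP[].
split => //.
have L0 : 0 <= L by apply: le_trans (FL 0 _ (xB 0)).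
move=> t tN; have close e : 0 < e -> exists2 d, 0 < d &
    forall r, t - d < r -> r < t + d -> `|F r (x r) - F t (x t)| < e.
  move=> e0; have [d d0 H] := cF t tN (x t) e e0.
  pose d' := d / (L + 1); have dd' : d = d' * (L + 1).
    by rewrite /d' divfK//; apply/eqP; lra.
  have d'0 : 0 < d' by rewrite divr_gt0//; lra.
  have Ld' : 0 <= L * d' by rewrite mulr_ge0// ltW.
  exists d' => // r h1 h2; apply: H; first by rewrite ltr_norml; apply/andP; split; lra.
  have [rt|tr] := lerP r t.
    rewrite distrC; apply: le_lt_trans (xL _ _ rt) _.
    by have : L * (t - r) <= L * d' by [apply: ler_wpM2l => //; lra]; lra.
  apply: le_lt_trans (xL _ _ (ltW tr)) _.
  by have : L * (r - t) <= L * d' by [apply: ler_wpM2l => //; lra]; lra.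
apply: derive_of_slopes => e e0; have [d d0 H] := close e e0;
    exists d => // a b ta at' tb bt.
  apply: inc; first lra.
  move=> r ar rb; have := H r ltac:(lra) ltac:(lra).
  by rewrite ltr_norml => /andP[]; lra.
suff : (F t (x t) - e) * (b - a) <= x b - x a by lra.
apply: dec; first lra.
move=> r ar rb; have := H r ltac:(lra) ltac:(lra).
by rewrite ltr_norml => /andP[]; lra.
Qed.

(** Let phi y be y - clamp(y) for the clamp to [- M, M].  As phi is nondecreasing
    and 1-Lipschitz and vanishes where F is not controlled, phi(x) is nonincreasing.
    So if x is above M at some time, it was above M at all earlier times, and if it
    is below - M, it stays there; either way x decreases at rate at least 1 over an
    infinite time, which contradicts boundedness. *)
Lemma bounded_solution_trapped {R : realType} (F : R -> R -> R) (N : set R)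
    (L B M : R) (x : R -> R) :
  (@lebesgue_measure R).-negligible N -> lip L x -> (forall t, `|x t| <= B) ->
  subsolution F N x -> 0 <= M -> (forall t y, M <= `|y| -> F t y <= - 1) ->
  forall t, `|x t| <= M.
Proof.
move=> N0 xL xB sx M0 FM.
have L0 : 0 <= L by have := xL 0 1 ler01; rewrite subr0 mulr1; apply: le_trans.
pose phi y := Num.max (y - M) 0 + Num.min (y + M) 0.
have phiP y : [/\ M <= y -> phi y = y - M, y <= - M -> phi y = y + M &
    - M <= y -> y <= M -> phi y = 0].
  by rewrite /phi; split; case: (lerP (y - M) 0) => ?; case: (lerP (y + M) 0) => ? //; lra.
have phi_le y z : y <= z -> 0 <= phi z - phi y <= z - y.
  by move=> yz; rewrite /phi; clear -yz M0;
    case: (lerP (y - M) 0) => ?; case: (lerP (y + M) 0) => ?;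
    case: (lerP (z - M) 0) => ?; case: (lerP (z + M) 0) => ?; apply/andP; split; lra.
clearbody phi; pose g t := phi (x t).
have gL : lip L g.
  move=> s t st; apply: le_trans (xL s t st); rewrite /g.
  have [h|h] := lerP (x s) (x t).
    by have /andP[? ?] := phi_le _ _ h; rewrite !ger0_norm; lra.
  by have /andP[? ?] := phi_le _ _ (ltW h); rewrite !ler0_norm; lra.
have sg t : ~ N t -> slope_le g t 0.
  move=> tN; have [xM|xM] := lerP M `|x t|.
    move=> e e0; have [d d0 H] := sx t tN e e0; exists d => // a b ta at' tb bt.
    have h1 := H a b ta at' tb bt.
    have h2 : (F t (x t) + e) * (b - a) <= e * (b - a).
      by rewrite ler_wpM2r ?subr_ge0//; [lra|have := FM t _ xM; lra].
    have h3 : 0 <= e * (b - a) by rewrite mulr_ge0//; lra.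
    rewrite /g; have [h|h] := lerP (x a) (x b).
      by have /andP[? ?] := phi_le _ _ h; lra.
    by have /andP[? ?] := phi_le _ _ (ltW h); lra.
  pose r := (M - `|x t|) / (L + 1).
  have rE : M - `|x t| = r * (L + 1) by rewrite /r divfK//; apply/eqP; lra.
  have r0 : 0 < r by rewrite divr_gt0//; lra.
  apply: (slope_le_near (fun=> 0) _ _ _ r) => //; last first.
    move=> e e0; exists 1 => // a b _ ? ? _.
    by rewrite subrr add0r mulr_ge0//; lra.
  move=> s ts st; rewrite /g; have [_ _ p3] := phiP (x s).
  have xst : `|x s - x t| <= L * r.
    have [h|h] := lerP s t.
      by rewrite distrC; apply: le_trans (xL _ _ h) _; apply: ler_wpM2l => //; lra.
    by apply: le_trans (xL _ _ (ltW h)) _; apply: ler_wpM2l => //; lra.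
  move: xst; rewrite ler_norml => /andP[h1 h2].
  have := ler_norm (x t); have := ler_norm (- x t); rewrite normrN => h3 h4.
  by rewrite p3//; lra.
have gdec a b : a <= b -> g b <= g a.
  move=> ab; suff : g b - g a <= 0 * (b - a) by lra.
  apply: (slope_le_increment g a b 0 N ab) => //; last by move=> t _ _; exact: sg.
  exact: lip_abs_continuous gL.
have B0 : 0 <= B by apply: le_trans (xB 0).
(* While x stays outside [- M, M], it loses one unit per unit of time; a time
   2 B + 1 is too long for values in [- B, B]. *)
have drop a b : a <= b -> b = a + (2 * B + 1) ->
    (forall r, a <= r -> r <= b -> M <= `|x r|) -> False.
  move=> ab bE H; have : x b - x a <= (- 1) * (b - a).
    apply: (slope_le_increment x a b (- 1) N ab) => //.
      exact: lip_abs_continuous xL.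
    move=> r ra rb rN; apply: slope_le_weaken (sx r rN); apply: FM; exact: H.
  by have := xB a; have := xB b; rewrite !ler_norml => /andP[? ?] /andP[? ?]; lra.
move=> t; rewrite ler_norml; apply/andP; split; rewrite leNgt; apply/negP => xt.
  apply: (drop t (t + (2 * B + 1))) => //; first lra.
  move=> r tr _; have := gdec _ _ tr; rewrite /g.
  have [_ pt _] := phiP (x t); rewrite (pt (ltW xt)).
  have [p1 p2 p3] := phiP (x r) => gr.
  have [h|h] := lerP (x r) (- M); first by rewrite ler0_norm; clear -h M0; lra.
  have [h'|h'] := lerP M (x r); first by rewrite ger0_norm; clear -h' M0; lra.
  by move: gr; rewrite p3; clear -xt h h'; lra.
apply: (drop (t - (2 * B + 1)) t); [lra|lra|].
move=> r _ rt; have := gdec _ _ rt; rewrite /g.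
have [pt _ _] := phiP (x t); rewrite (pt (ltW xt)).
have [p1 p2 p3] := phiP (x r) => gr.
have [h|h] := lerP (x r) (- M); first by rewrite ler0_norm; clear -h M0; lra.
have [h'|h'] := lerP M (x r); first by rewrite ger0_norm; clear -h' M0; lra.
by move: gr; rewrite p3; clear -xt h h'; lra.
Qed.

(** * The quadratic equation and its bifurcation value *)

Definition riccati {R : realType} (q p : R -> R) (l t y : R) : R :=
  - y ^+ 2 + q t * y + p t + l.

(** What the existence theory uses of a BPUC coefficient; with N fixed, the class
    is closed under sums and products, as the coefficients 2 c Gamma and
    p - c^2 Gamma^2 require. *)
Definition tame {R : realType} (N : set R) (B : R) (q : R -> R) : Prop :=
  (forall t, `|q t| <= B) /\ (forall t, ~ N t -> {for t, continuous q}).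

Lemma riccati_continuous_off {R : realType} (N : set R) (Q P l : R) (q p : R -> R) :
  tame N Q q -> tame N P p -> continuous_off N (riccati q p l).
Proof.
move=> [_ cq] [_ cp] t tN y e e0.
have hq : q z.1 @[z --> (t, y)] --> q t.
  apply: (@cvg_comp _ _ _ fst q _ (nbhs t) _ _ (cq t tN)).
  exact: (@cvg_fst _ _ (nbhs t) (nbhs y)).
have hp : p z.1 @[z --> (t, y)] --> p t.
  apply: (@cvg_comp _ _ _ fst p _ (nbhs t) _ _ (cp t tN)).
  exact: (@cvg_fst _ _ (nbhs t) (nbhs y)).
have hy : z.2 @[z --> (t, y)] --> y by exact: (@cvg_snd _ _ (nbhs t) (nbhs y)).
have : riccati q p l z.1 z.2 @[z --> (t, y)] --> riccati q p l t y.
  apply: cvgD; last exact: cvg_cst.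
  apply: cvgD; last exact: hp.
  by apply: cvgD; [apply: cvgN; rewrite expr2; apply: cvgM|apply: cvgM].
move=> /cvgrPdist_lt /(_ e e0) /nbhs_ballP[d /= d0 H]; exists d => // t' y' ht hy'.
by rewrite distrC; apply: (H (t', y')); split; rewrite /= /ball /= distrC.
Qed.

Lemma riccati_bound {R : realType} (q p : R -> R) (Q P M l t y : R) :
  `|q t| <= Q -> `|p t| <= P -> `|y| <= M ->
  `|riccati q p l t y| <= M ^+ 2 + Q * M + P + `|l|.
Proof.
move=> qQ pP yM; rewrite /riccati.
have h1 : `|y ^+ 2| <= M ^+ 2.
  by rewrite normrX lerXn2r ?nnegrE//; apply: le_trans yM.
have h2 : `|q t * y| <= Q * M by rewrite normrM ler_pM.
apply: le_trans (ler_normD _ _) _; apply: lerD => //.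
apply: le_trans (ler_normD _ _) _; apply: lerD => //.
apply: le_trans (ler_normD _ _) _; apply: lerD => //.
by rewrite normrN.
Qed.

Lemma riccati_le {R : realType} (q p : R -> R) (Q P l t y : R) :
  `|q t| <= Q -> `|p t| <= P ->
  riccati q p l t y <= - `|y| ^+ 2 + Q * `|y| + P + l.
Proof.
move=> qQ pP; rewrite /riccati real_normK ?num_real//.
have h1 : q t * y <= Q * `|y|.
  by apply: le_trans (ler_norm _) _; rewrite normrM ler_wpM2r.
by have := ler_norm (p t); lra.
Qed.

Lemma riccati_large {R : realType} (q p : R -> R) (Q P l t y : R) :
  `|q t| <= Q -> `|p t| <= P -> Q + P + `|l| + 1 <= `|y| ->
  riccati q p l t y <= - 1.
Proof.
move=> qQ pP yM; apply: le_trans (riccati_le q p Q P l t y qQ pP) _.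
have Q0 : 0 <= Q by exact: le_trans qQ.
have P0 : 0 <= P by exact: le_trans pP.
have l0 := normr_ge0 l; have ll := ler_norm l.
have h : 1 * (P + `|l| + 1) <= `|y| * (`|y| - Q) by apply: ler_pM; lra.
by rewrite expr2; lra.
Qed.

(** The bound and the Lipschitz constant depend only on Q, P and |l|; this is what
    makes the estimates in c and the passage to the limit in l uniform. *)
Lemma has_bounded_solution_regular {R : realType} (N : set R) (Q P l : R)
    (q p : R -> R) :
  (@lebesgue_measure R).-negligible N -> tame N Q q -> tame N P p ->
  has_bounded_solution q p l ->
  let M := Q + P + `|l| + 1 in
  exists x, [/\ lip (M ^+ 2 + Q * M + P + `|l|) x, forall t, `|x t| <= M &
    forall t, ~ N t -> is_derive t 1 x (riccati q p l t (x t))].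
Proof.
move=> N0 tq tp [x [sol xb]] M.
have cF := riccati_continuous_off N Q P l q p tq tp.
have [B xB] : exists B, forall t, `|x t| <= B.
  have [B [_ HB]] := xb; exists (B + 1) => t.
  by apply: (HB (B + 1)) => //; lra.
have [xL dx] := caratheodory_solution_lip _ N (B ^+ 2 + Q * B + P + `|l|) B x cF sol xB
  (fun t y yB => riccati_bound q p Q P B l t y (tq.1 t) (tp.1 t) yB).
have sx : subsolution (riccati q p l) N x.
  by move=> t tN; apply: slope_le_derive; exact: dx.
have M0 : 0 <= M.
  have := le_trans (normr_ge0 _) (tq.1 0); have := le_trans (normr_ge0 _) (tp.1 0).
  by have := normr_ge0 l; rewrite /M; lra.
have xM := bounded_solution_trapped _ N _ B M x N0 xL xB sx M0
  (fun t y yM => riccati_large q p Q P l t y (tq.1 t) (tp.1 t) yM).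
have [xL' _] := caratheodory_solution_lip _ N _ M x cF sol xM
  (fun t y yB => riccati_bound q p Q P M l t y (tq.1 t) (tp.1 t) yB).
by exists x.
Qed.

(** The existence criterion behind all comparisons.  The bound M is taken large
    enough for F to be negative at M and for w to be admissible. *)
Lemma has_bounded_solution_of_subsolution {R : realType} (N : set R)
    (Q P l L B : R) (q p w : R -> R) :
  (@lebesgue_measure R).-negligible N -> tame N Q q -> tame N P p ->
  lip L w -> (forall t, `|w t| <= B) -> subsolution (riccati q p l) N w ->
  has_bounded_solution q p l.
Proof.
move=> N0 tq tp wL wB sw.
have cF := riccati_continuous_off N Q P l q p tq tp.
pose M : R := Num.max (Q + P + `|l| + 1) B.
have M1 : Q + P + `|l| + 1 <= M by rewrite le_max lexx.
have MB : B <= M by rewrite le_max lexx orbT.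
pose L' := Num.max L (M ^+ 2 + Q * M + P + `|l| + 1).
have L1 : L <= L' by rewrite le_max lexx.
have L2 : M ^+ 2 + Q * M + P + `|l| + 1 <= L' by rewrite le_max lexx orbT.
have M0 : 0 <= M by exact: le_trans (le_trans (normr_ge0 _) (wB 0)) MB.
have [|||X [XL XM dX]] := perron_solution (riccati q p l) N L' M w N0 cF.
- move=> t y yM; apply: le_trans L2; rewrite lerD2r.
  exact: riccati_bound (tq.1 t) (tp.1 t) yM.
- move=> t; have := riccati_large q p Q P l t M (tq.1 t) (tp.1 t).
  by rewrite (ger0_norm M0) => /(_ M1); lra.
- by split => //; [exact: lip_weaken wL|move=> t; exact: le_trans (wB t) MB].
exists X; split; first exact: lip_solution_caratheodory N0 XL dX.
exists M; split; first exact: num_real.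
by move=> z Mz t _; apply: le_trans (XM t) (ltW Mz).
Qed.

Lemma has_bounded_solution_le {R : realType} (N : set R) (Q P l l' : R)
    (q p : R -> R) :
  (@lebesgue_measure R).-negligible N -> tame N Q q -> tame N P p -> l <= l' ->
  has_bounded_solution q p l -> has_bounded_solution q p l'.
Proof.
move=> N0 tq tp ll /(has_bounded_solution_regular N Q P l q p N0 tq tp)[x [xL xM dx]].
apply: (has_bounded_solution_of_subsolution N Q P l' _ _ q p x N0 tq tp xL xM).
move=> t tN; apply: (@slope_le_weaken _ _ _ (riccati q p l t (x t))).
  by rewrite /riccati; lra.
by apply: slope_le_derive; exact: dx.
Qed.

Lemma has_bounded_solution_large {R : realType} (N : set R) (Q P : R) (q p : R -> R) :
  (@lebesgue_measure R).-negligible N -> tame N Q q -> tame N P p ->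
  has_bounded_solution q p P.
Proof.
move=> N0 tq tp.
apply: (has_bounded_solution_of_subsolution N Q P P 0 0 q p (fun=> 0) N0 tq tp).
- by move=> s t st; rewrite subrr normr0 mul0r.
- by move=> t; rewrite normr0.
move=> t tN e e0; exists 1 => // u v _ ut tv _.
rewrite subrr mulr_ge0// /riccati ?subr_ge0; last lra.
by have := tp.1 t; rewrite ler_norml expr2 !mulr0 => /andP[? ?]; lra.
Qed.

(** The maximum of - y^2 + Q y + P + l over y is Q^2 / 4 + P + l; below the stated
    level it is less than - 1, and every solution decreases at rate at least 1. *)
Lemma has_bounded_solution_ge {R : realType} (N : set R) (Q P l : R) (q p : R -> R) :
  (@lebesgue_measure R).-negligible N -> tame N Q q -> tame N P p ->
  has_bounded_solution q p l -> - (P + Q ^+ 2 / 4 + 1) <= l.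
Proof.
move=> N0 tq tp hb; rewrite leNgt; apply/negP => hl.
have [x [xL xM dx]] := has_bounded_solution_regular N Q P l q p N0 tq tp hb.
have F1 t y : riccati q p l t y <= - 1.
  apply: le_trans (riccati_le q p Q P l t y (tq.1 t) (tp.1 t)) _.
  by have := sqr_ge0 (`|y| - Q / 2); rewrite !expr2; rewrite expr2 in hl; lra.
have sx : subsolution (riccati q p l) N x.
  by move=> t tN; apply: slope_le_derive; exact: dx.
have x0 := bounded_solution_trapped _ N _ _ 0 x N0 xL xM sx (lexx 0) (fun t y _ => F1 t y).
have : x 1 - x 0 <= (- 1) * (1 - 0).
  apply: (slope_le_increment x 0 1 (- 1) N ler01 _ N0); first exact: lip_abs_continuous xL.
  by move=> t _ _ tN; apply: slope_le_weaken (sx t tN).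
by have := x0 0; have := x0 1; rewrite !ler_norml => /andP[? ?] /andP[? ?]; lra.
Qed.

(** Solutions for l' slightly above l are subsolutions for l up to l' - l, with
    common bounds; their lower limit is a subsolution for l itself. *)
Lemma has_bounded_solution_closed {R : realType} (N : set R) (Q P l : R) (q p : R -> R) :
  (@lebesgue_measure R).-negligible N -> tame N Q q -> tame N P p ->
  (forall th, 0 < th -> exists2 l', has_bounded_solution q p l' & l <= l' < l + th) ->
  has_bounded_solution q p l.
Proof.
move=> N0 tq tp H.
have cF := riccati_continuous_off N Q P l q p tq tp.
have Q0 := le_trans (normr_ge0 _) (tq.1 0); have P0 := le_trans (normr_ge0 _) (tp.1 0).
pose M := Q + P + (`|l| + 1) + 1; pose L := M ^+ 2 + Q * M + P + (`|l| + 1).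
have M0 : 0 <= M by have := normr_ge0 l; rewrite /M; lra.
have L0 : 0 <= L.
  have := normr_ge0 l; have := sqr_ge0 M; have : 0 <= Q * M by rewrite mulr_ge0.
  by rewrite /L; lra.
have [|X [XL XM sX]] := subsolution_limit (riccati q p l) N L M N0 cF L0; last first.
  exact: (has_bounded_solution_of_subsolution N Q P l L M q p X).
move=> th th0; pose th' := Num.min th 1.
have th'0 : 0 < th' by rewrite lt_min th0 ltr01.
have th'1 : th' <= 1 by rewrite ge_min lexx orbT.
have th'th : th' <= th by rewrite ge_min lexx.
have [l' hl' /andP[l1 l2]] := H _ th'0.
have l'l : `|l'| <= `|l| + 1.
  have := ler_norm l; have := ler_norm (- l); rewrite normrN ler_norml => ? ?.
  by apply/andP; split; lra.
have [x [xL xM dx]] := has_bounded_solution_regular N Q P l' q p N0 tq tp hl'.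
set M' := Q + P + `|l'| + 1 in xL xM.
have M'M : M' <= M by rewrite /M' /M; lra.
have M'0 : 0 <= M' by have := normr_ge0 l'; rewrite /M'; lra.
exists x; split; [|by move=> t; apply: le_trans (xM t) M'M|].
  apply: lip_weaken xL; have : Q * M' <= Q * M by rewrite ler_wpM2l.
  have : M' ^+ 2 <= M ^+ 2 by rewrite lerXn2r ?nnegrE.
  by rewrite /L; lra.
move=> t tN; apply: (@slope_le_weaken _ _ _ (riccati q p l' t (x t))).
  by rewrite /riccati; lra.
by apply: slope_le_derive; exact: dx.
Qed.

Lemma lambda_starP {R : realType} (N : set R) (Q P : R) (q p : R -> R) :
  (@lebesgue_measure R).-negligible N -> tame N Q q -> tame N P p ->
  is_bifurcation_value q p (lambda_star q p).
Proof.
move=> N0 tq tp; rewrite /lambda_star.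
suff : exists l0, is_bifurcation_value q p l0.
  move=> [l0 h].
  exact: (@xgetPex _ 0 [set l | is_bifurcation_value q p l] (ex_intro _ l0 h)).
pose A := [set l | has_bounded_solution q p l].
have hA : has_inf A.
  split; first by exists P; exact: has_bounded_solution_large N0 tq tp.
  by exists (- (P + Q ^+ 2 / 4 + 1)) => l; exact: has_bounded_solution_ge N0 tq tp.
exists (inf A) => l; split => [hl|]; first exact: ge_inf hA.2 _ hl.
move=> /(has_bounded_solution_le N Q P _ _ q p N0 tq tp); apply.
apply: (has_bounded_solution_closed N Q P _ q p N0 tq tp) => th th0.
have [l' Al' l'th] := inf_adherent th0 hA; exists l' => //.
by rewrite l'th andbT; exact: ge_inf hA.2 _ Al'.
Qed.

(** * BPUC coefficients *)

Lemma tame_subset {R : realType} (N N' : set R) (B : R) (q : R -> R) :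
  N `<=` N' -> tame N B q -> tame N' B q.
Proof. by move=> NN [qB cq]; split => // t tN; apply: cq => /NN. Qed.

Lemma tameD {R : realType} (N : set R) (B C : R) (q r : R -> R) :
  tame N B q -> tame N C r -> tame N (B + C) (fun t => q t + r t).
Proof.
move=> [qB cq] [rC cr]; split => [t|t tN].
  by apply: le_trans (ler_normD _ _) _; exact: lerD.
by apply: cvgD; [exact: cq|exact: cr].
Qed.

Lemma tameM {R : realType} (N : set R) (B C : R) (q r : R -> R) :
  tame N B q -> tame N C r -> tame N (B * C) (fun t => q t * r t).
Proof.
move=> [qB cq] [rC cr]; split => [t|t tN].
  by rewrite normrM ler_pM.
by apply: cvgM; [exact: cq|exact: cr].
Qed.

Lemma tame_cst {R : realType} (N : set R) (B c : R) :
  `|c| <= B -> tame N B (fun=> c).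
Proof. by move=> cB; split => // t _; exact: cst_continuous. Qed.

Lemma tame_sum {R : realType} (N : set R) (n : nat) (q_ : 'I_n -> R -> R) :
  (forall i, exists B, tame N B (q_ i)) ->
  exists B, tame N B (fun t => \sum_(i < n) q_ i t).
Proof.
elim: n q_ => [|n IH] q_ H.
  exists 0; have -> : (fun t => \sum_(i < 0) q_ i t) = (fun=> 0 : R).
    by apply/funext => t; rewrite big_ord0.
  by apply: tame_cst; rewrite normr0.
have [B HB] := IH (fun i => q_ (widen_ord (leqnSn n) i)) (fun i => H _).
have [C HC] := H ord_max; exists (B + C).
have -> : (fun t => \sum_(i < n.+1) q_ i t) =
    (fun t => \sum_(i < n) q_ (widen_ord (leqnSn n) i) t + q_ ord_max t).
  by apply/funext => t; rewrite big_ord_recr.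
exact: tameD.
Qed.

(** The gaps have a positive lower bound, so the points a j run from - oo to + oo. *)
Lemma disperse_cover {R : realType} (a : int -> R) (t : R) :
  disperse a -> exists j, a j <= t < a (j + 1).
Proof.
rewrite /disperse; set A := (X in inf X) => A0.
have hA : has_inf A by apply: contrapT => /inf_out A'; rewrite A' ltxx in A0.
have gap j : inf A <= a (j + 1) - a j by apply: ge_inf; [exact: hA.2|exists j].
have up (k : int) (n : nat) : a k + n%:R * inf A <= a (k + n%:Z).
  elim: n => [|n IHn]; first by rewrite mul0r !addr0.
  have -> : k + n.+1%:Z = k + n%:Z + 1 by rewrite -addn1 PoszD addrA.
  rewrite -natr1 mulrDl mul1r.
  by have := gap (k + n%:Z); lra.
pose n0 := Num.bound `|(a 0 - t) / inf A|.
have lo : a (- n0%:Z) <= t.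
  have := up (- n0%:Z) n0; rewrite addNr.
  have : (a 0 - t) / inf A < n0%:R by
    apply: le_lt_trans (ler_norm _) _; exact: archi_boundP.
  by rewrite ltr_pdivrMr//; lra.
have ex : exists n : nat, t < a (- n0%:Z + n%:Z).
  pose n1 := Num.bound `|(t - a (- n0%:Z)) / inf A|; exists n1.
  have := up (- n0%:Z) n1.
  have : (t - a (- n0%:Z)) / inf A < n1%:R by
    apply: le_lt_trans (ler_norm _) _; exact: archi_boundP.
  by rewrite ltr_pdivrMr//; lra.
have := ex_minnP ex; case=> [[|n]] tn nmin; first by move: tn; rewrite addr0; lra.
exists (- n0%:Z + n%:Z); apply/andP; split.
  by rewrite leNgt; apply/negP => /nmin; rewrite ltnn.
by rewrite -addrA -PoszD addn1.
Qed.

Lemma BPUC_on_tame {R : realType} (a : int -> R) (q : R -> R) :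
  disperse a -> BPUC_on a q -> exists B, tame (range a) B q.
Proof.
move=> da [[B [_ qb]] _ uc]; exists (B + 1); split => [t|t ta].
  by apply: (qb (B + 1)) => //; lra.
have [j /andP[jt tj]] := disperse_cover a t da.
have {}jt : a j < t by rewrite lt_neqAle jt andbT; apply/eqP => ajt; apply: ta; exists j.
apply/cvgrPdist_lt => e e0; have [d d0 H] := uc e e0.
apply/nbhs_ballP; exists (Num.min d (Num.min (t - a j) (a (j + 1) - t))).
  by rewrite /= !lt_min d0 !subr_gt0 jt.
move=> s; rewrite /ball /= !lt_min => /and3P[sd s1 s2].
apply: (H j) => //; rewrite in_itv/=; apply/andP; split => //.
  by move: s1; rewrite ltr_norml => /andP[]; lra.
by move: s2; rewrite ltr_norml => /andP[]; lra.
Qed.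

Lemma BPUC_tame {R : realType} (q : R -> R) : BPUC q ->
  exists N B, (@lebesgue_measure R).-negligible N /\ tame N B q.
Proof.
move=> [n [a [q_ [H qE]]]].
pose N := range (fun ij : 'I_n.+1 * int => a ij.1 ij.2).
have N0 : (@lebesgue_measure R).-negligible N.
  have cN : countable N by apply: card_le_trans (card_image_le _ _) _; exact: countableP.
  apply/negligibleP; first exact: countable_measurable.
  exact: countable_lebesgue_measure0.
have [i|B HB] := @tame_sum R N n.+1 q_.
  have [da bq] := H i; have [B HB] := BPUC_on_tame (a i) (q_ i) da bq.
  by exists B; apply: tame_subset HB => _ [j _ <-]; exists (i, j).
exists N, B; split => //; have -> // : q = (fun t => \sum_(i < n.+1) q_ i t).
exact/funext.
Qed.

(** * Comparison of bifurcation values *)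

(** To bound one bifurcation value by another, it is enough to turn a bounded
    solution of the first equation, at its bifurcation value l, into a bounded
    subsolution of the second one at l + k. *)
Lemma lambda_star_le {R : realType} (N : set R) (Q P Q' P' k : R)
    (q p q' p' : R -> R) :
  (@lebesgue_measure R).-negligible N -> tame N Q q -> tame N P p ->
  tame N Q' q' -> tame N P' p' ->
  let l := lambda_star q p in
  (forall x, (forall t, `|x t| <= Q + P + `|l| + 1) ->
     (exists L, lip L x) ->
     (forall t, ~ N t -> is_derive t 1 x (riccati q p l t (x t))) ->
     exists (L B : R) (z : R -> R), [/\ lip L z, forall t, `|z t| <= B &
       subsolution (riccati q' p' (l + k)) N z]) ->
  lambda_star q' p' <= l + k.
Proof.
move=> N0 tq tp tq' tp' l H.
have := lambda_starP N Q P q p N0 tq tp l => -[_ /(_ (lexx _)) hl].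
have [x [xL xM dx]] := has_bounded_solution_regular N Q P l q p N0 tq tp hl.
have [L [B [z [zL zB sz]]]] := H x xM (ex_intro (fun L => lip L x) _ xL) dx.
apply/(lambda_starP N Q' P' q' p' N0 tq' tp').
exact: (has_bounded_solution_of_subsolution N Q' P' _ L B _ _ z).
Qed.

Lemma lambda_star_bound {R : realType} (N : set R) (Q P : R) (q p : R -> R) :
  (@lebesgue_measure R).-negligible N -> tame N Q q -> tame N P p ->
  `|lambda_star q p| <= P + Q ^+ 2 / 4 + 1.
Proof.
move=> N0 tq tp; have bif := lambda_starP N Q P q p N0 tq tp.
rewrite ler_norml; apply/andP; split.
  by apply: (has_bounded_solution_ge N Q P _ q p N0 tq tp); apply/bif.
have : lambda_star q p <= P by apply/bif; exact: has_bounded_solution_large N0 tq tp.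
by have := sqr_ge0 Q; lra.
Qed.

Lemma tame_hat {R : realType} (N : set R) (G P c kappa : R) (Gamma p : R -> R) :
  tame N G Gamma -> tame N P p -> `|c| <= kappa ->
  tame N (2 * kappa * G) (fun t => 2 * c * Gamma t) /\
  tame N (P + kappa ^+ 2 * G ^+ 2) (fun t => p t - c ^+ 2 * Gamma t ^+ 2).
Proof.
move=> tG tp ck; split.
  by apply: tameM => //; apply: tame_cst; rewrite normrM ger0_norm// ler_wpM2l.
have -> : (fun t => p t - c ^+ 2 * Gamma t ^+ 2) =
    (fun t => p t + (- c ^+ 2) * (Gamma t * Gamma t)).
  by apply/funext => t; rewrite mulNr expr2.
apply: tameD => //; apply: tameM; last exact: tameM.
by apply: tame_cst; rewrite normrN normrX lerXn2r ?nnegrE//; apply: le_trans ck.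
Qed.

Lemma lambda_hat_lip_on {R : realType} (N : set R) (G P kappa : R) (Gamma p : R -> R) :
  (@lebesgue_measure R).-negligible N -> tame N G Gamma -> tame N P p ->
  exists2 m, 0 < m & forall c1 c2 : R, `|c1| <= kappa -> `|c2| <= kappa ->
    lambda_hat Gamma p c2 <= lambda_hat Gamma p c1 + m * `|c1 - c2|.
Proof.
move=> N0 tG tp.
have G0 := le_trans (normr_ge0 _) (tG.1 0).
set Q := 2 * kappa * G; set P' := P + kappa ^+ 2 * G ^+ 2.
pose M := Q + P' + (P' + Q ^+ 2 / 4 + 1) + 1.
pose m := `|G * (2 * M + 2 * kappa * G)| + 1.
exists m; first by have := normr_ge0 (G * (2 * M + 2 * kappa * G)); rewrite /m; lra.
move=> c1 c2 k1 k2.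
have [tq1 tp1] := tame_hat N G P c1 kappa Gamma p tG tp k1.
have [tq2 tp2] := tame_hat N G P c2 kappa Gamma p tG tp k2.
apply: (lambda_star_le N Q P' Q P' _ _ _ _ _ N0 tq1 tp1 tq2 tp2).
move=> x xM [L xL] dx; exists L, M, x; split => //.
  move=> t; apply: le_trans (xM t) _.
  by have := lambda_star_bound N _ _ _ _ N0 tq1 tp1; rewrite -/Q -/P' /M; lra.
move=> t tN; apply: slope_le_weaken (slope_le_derive _ _ _ (dx t tN)).
have xtM : `|x t| <= M.
  apply: le_trans (xM t) _.
  by have := lambda_star_bound N _ _ _ _ N0 tq1 tp1; rewrite -/Q -/P' /M; lra.
rewrite /riccati -/(lambda_hat Gamma p c1); set l := lambda_hat _ _ _.
suff : (c1 - c2) * (Gamma t * (2 * x t - (c1 + c2) * Gamma t)) <= m * `|c1 - c2|.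
  by rewrite !expr2; lra.
apply: le_trans (ler_norm _) _; rewrite normrM mulrC ler_wpM2r//.
apply: (@le_trans _ _ (G * (2 * M + 2 * kappa * G))); last first.
  by have := ler_norm (G * (2 * M + 2 * kappa * G)); rewrite /m; lra.
rewrite normrM; apply: ler_pM => //; first exact: tG.1.
apply: le_trans (ler_normB _ _) _; apply: lerD.
  by rewrite normrM ger0_norm// ler_wpM2l.
rewrite normrM; apply: ler_pM => //; last exact: tG.1.
by apply: le_trans (ler_normD _ _) _; lra.
Qed.

Lemma lip_derive {R : realType} (f : R -> R) (D : R) :
  (forall t, derivable f t 1) -> (forall t, `|f^`()%classic t| <= D) -> lip D f.
Proof.
move=> df fD s t st.
have [||x _ ->] := @MVT_segment R f f^`()%classic s t st.
- by move=> x _; apply: DeriveDef; [exact: df|rewrite derive1E].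
- by apply: derivable_within_continuous => x _; exact: df.
by rewrite normrM (@ger0_norm _ (t - s)) ?subr_ge0// ler_wpM2r ?subr_ge0.
Qed.

Lemma lambda_hat_lip_derive {R : realType} (N : set R) (G P D : R) (Gamma p : R -> R) :
  (@lebesgue_measure R).-negligible N -> tame N G Gamma -> tame N P p ->
  (forall t, derivable Gamma t 1) -> (forall t, `|Gamma^`()%classic t| <= D) ->
  forall c1 c2 : R,
    lambda_hat Gamma p c2 <= lambda_hat Gamma p c1 + D * `|c1 - c2|.
Proof.
move=> N0 tG tp dG GD c1 c2.
have GL := lip_derive Gamma D dG GD.
have [tq1 tp1] := tame_hat N G P c1 _ Gamma p tG tp (lexx _).
have [tq2 tp2] := tame_hat N G P c2 _ Gamma p tG tp (lexx _).
apply: (lambda_star_le N _ _ _ _ _ _ _ _ _ N0 tq1 tp1 tq2 tp2).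
set l := lambda_star _ _; set M := _ + 1; move=> x xM [L xL] dx.
exists (L + `|c2 - c1| * D), (M + `|c2 - c1| * G), (fun t => x t + (c2 - c1) * Gamma t).
split.
- move=> s t st.
  have -> : x t + (c2 - c1) * Gamma t - (x s + (c2 - c1) * Gamma s) =
    (x t - x s) + (c2 - c1) * (Gamma t - Gamma s) by lra.
  apply: le_trans (ler_normD _ _) _; rewrite [leRHS]mulrDl; apply: lerD; first exact: xL.
  by rewrite normrM -mulrA ler_wpM2l//; exact: GL.
- move=> t; apply: le_trans (ler_normD _ _) _; apply: lerD => //.
  by rewrite normrM ler_wpM2l//; exact: tG.1.
move=> t tN.
have dGt : is_derive t 1 Gamma (Gamma^`()%classic t).
  by apply: DeriveDef; [exact: dG|rewrite derive1E].
have dz := is_deriveD (dx t tN) (is_deriveZ (c2 - c1) dGt).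
apply: slope_le_weaken (slope_le_derive _ _ _ dz).
rewrite /riccati /=.
suff : (c2 - c1) *: Gamma^`()%classic t <= D * `|c1 - c2|.
  by rewrite !expr2; lra.
apply: le_trans (ler_norm _) _.
by rewrite normrM mulrC distrC ler_wpM2r.
Qed.

(** * Lipschitz continuity of the bifurcation value *)

Lemma lipschitz_in {R : realType} (f : R -> R) (U : set R) (m : R) :
  (forall x y, U x -> U y -> `|f x - f y| <= m * `|x - y|) ->
  [lipschitz f x | x in U].
Proof.
move=> H; exists m; split; first exact: num_real.
move=> M mM [x y] [/= Ux Uy]; apply: le_trans (H x y Ux Uy) _.
by rewrite ler_wpM2r// ltW.
Qed.

Lemma locally_lip_continuous {R : realType} (f : R -> R) :
  (forall kappa : R, 0 < kappa -> exists2 m : R, 0 < m &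
     forall x y : R, x \in `[- kappa, kappa] -> y \in `[- kappa, kappa] ->
       `|f x - f y| <= m * `|x - y|) ->
  forall x, exists2 U : set R, nbhs x U &
    [lipschitz f y | y in U] /\ {for x, continuous f}.
Proof.
move=> H x; have k0 : 0 < `|x| + 1 by have := normr_ge0 x; lra.
have [m m0 Hm] := H _ k0.
have xU y : ball x 1 y -> y \in `[- (`|x| + 1), `|x| + 1].
  rewrite /ball /= ltr_norml in_itv/= => /andP[h1 h2].
  have := ler_norm x; have := ler_norm (- x); rewrite normrN => h3 h4.
  by apply/andP; split; lra.
exists (ball x 1); first exact: nbhsx_ballx.
split; first by apply: (lipschitz_in _ _ m) => y z /xU yU /xU zU; exact: Hm.
apply/cvgrPdist_lt => e e0; apply/nbhs_ballP.
exists (Num.min 1 (e / m)); first by rewrite /= lt_min ltr01 divr_gt0.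
move=> y; rewrite /ball /= lt_min => /andP[y1 ye].
apply: le_lt_trans (Hm x y _ _) _; [by apply: xU; exact: ballxx|exact: xU|].
by rewrite mulrC -ltr_pdivlMr.
Qed.

Theorem proposition3p11 (R : realType) (Gamma p : R -> R)
    (hGamma : BPUC Gamma) (hp : BPUC p) :
  ((forall kappa : R, 0 < kappa -> exists2 m : R, 0 < m &
      forall c1 c2 : R, c1 \in `[- kappa, kappa] -> c2 \in `[- kappa, kappa] ->
        `|lambda_hat Gamma p c1 - lambda_hat Gamma p c2| <= m * `|c1 - c2|) /\
   continuous (lambda_hat Gamma p) /\
   (forall c0 : R, exists2 U : set R, nbhs c0 U &
      [lipschitz (lambda_hat Gamma p c) | c in U])) /\
  ((forall t : R, derivable Gamma t 1) -> continuous (Gamma^`())%classic ->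
   has_ubound (range (fun t => `|(Gamma^`())%classic t|)) ->
   (forall c1 c2 : R,
      `|lambda_hat Gamma p c1 - lambda_hat Gamma p c2|
        <= sup_norm (Gamma^`())%classic * `|c1 - c2|) /\
   [lipschitz (lambda_hat Gamma p c) | c in [set: R]]).
Proof.
have [N1 [G [N10 tG]]] := BPUC_tame Gamma hGamma.
have [N2 [P [N20 tp]]] := BPUC_tame p hp.
have N0 := negligibleU N10 N20.
have {}tG : tame (N1 `|` N2) G Gamma by apply: tame_subset tG; exact: subsetUl.
have {}tp : tame (N1 `|` N2) P p by apply: tame_subset tp; exact: subsetUr.
have loc : forall kappa : R, 0 < kappa -> exists2 m : R, 0 < m &
    forall c1 c2 : R, c1 \in `[- kappa, kappa] -> c2 \in `[- kappa, kappa] ->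
      `|lambda_hat Gamma p c1 - lambda_hat Gamma p c2| <= m * `|c1 - c2|.
  move=> kappa _; have [m m0 H] := lambda_hat_lip_on _ G P kappa Gamma p N0 tG tp.
  exists m => // c1 c2; rewrite !in_itv/= -!ler_norml => h1 h2.
  have := H c1 c2 h1 h2; have := H c2 c1 h2 h1; rewrite (distrC c2 c1) => ? ?.
  by rewrite ler_norml; apply/andP; split; lra.
split; first split => //; first split.
- by move=> c; have [U _ []] := locally_lip_continuous _ loc c.
- by move=> c; have [U cU []] := locally_lip_continuous _ loc c; exists U.
move=> dG _ ubG.
have GD t : `|(Gamma^`())%classic t| <= sup_norm (Gamma^`())%classic.
  by apply: ub_le_sup => //; exists t.
have glob : forall c1 c2 : R, `|lambda_hat Gamma p c1 - lambda_hat Gamma p c2|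
    <= sup_norm (Gamma^`())%classic * `|c1 - c2|.
  move=> c1 c2; have H := lambda_hat_lip_derive _ G P _ Gamma p N0 tG tp dG GD.
  have := H c1 c2; have := H c2 c1; rewrite (distrC c2 c1) => ? ?.
  by rewrite ler_norml; apply/andP; split; lra.
split => //; exact: lipschitz_in (fun c1 c2 _ _ => glob c1 c2).
Qed.
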